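(* Let $f\in\mathbb{R}[x_1,\ldots,x_n]$, let $S\subset\mathbb{R}^n$ be a locally closed basic semialgebraic set, and let $\bar x\in S$. Assume that $\bar x$ satisfies the first-order condition $$\nabla f(\bar x)v\ge0\qquad\text{for all }v\in T_S(\bar x),$$ and that $S$ is algebraically parabolically regular at $(\bar x,u)$ for every nonzero critical direction $u$. Suppose that there exists $\eta>0$ such that $$Q_f(\bar x;u,w):=\nabla f(\bar x)w+u^T\nabla^2f(\bar x)u\ge\eta$$ for every critical direction $u\in T_S(\bar x)$ with $\|u\|=1$ and every $w\in\mathcal{L}^2_S(\bar x;u)$. Then $\bar x$ satisfies quadratic growth: there exist $c>0$ and $\varepsilon>0$ such that $$f(x)\ge f(\bar x)+c\|x-\bar x\|^2\qquad\text{for all }x\in S\cap B(\bar x,\varepsilon).$$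
   Context: Bouligand tangent cone: $T_S(\bar x)=\{u\in\mathbb{R}^n:\exists t_k\downarrow 0,\ \exists u_k\to u \text{ with } \bar x+t_ku_k\in S\text{ for all }k\}$ ($t_k\downarrow0$ means $t_k>0$, $t_k\to0$). A direction $u\in T_S(\bar x)$ is critical for $f$ at $\bar x$ if $\nabla f(\bar x)u=0$. $B(\bar x,\varepsilon)$ is the Euclidean ball. $S$ is described near $\bar x$ by polynomials as $\{x:g(x)=0,\ h(x)\le0\}$, $g=(g_1,\ldots,g_r)$, $h=(h_1,\ldots,h_s)$. Put $I(\bar x)=\{j:h_j(\bar x)=0\}$ and $I_0(\bar x;u)=\{j\in I(\bar x):\nabla h_j(\bar x)u=0\}$. Then $\mathcal{L}^2_S(\bar x;u)$ is the set of $w\in\mathbb{R}^n$ with $Dg(\bar x)w+D^2g(\bar x)[u,u]=0$ and $\nabla h_j(\bar x)w+u^T\nabla^2h_j(\bar x)u\le0$ for all $j\in I_0(\bar x;u)$, where $D^2g(\bar x)[u,u]=(u^T\nabla^2g_i(\bar x)u)_{i=1}^r$. Algebraic parabolic regularity at $(\bar x,u)$ means both of the following. (1) Directional rank stability: with $\mathcal{A}_0(\bar x;u)=\{g_1,\ldots,g_r\}\cup\{h_j:j\in I_0(\bar x;u)\}$, there exist a neighborhood $U$ of $\bar x$, a conic neighborhood $V$ of $u$, and an integer $\rho$ such that for every feasible arc $\gamma$ (a continuous curve $\gamma:(0,\varepsilon)\to S$) with $\gamma(t)=\bar x+tv+O(t^2)$, $v\in V$, whose points lie in $U$ and whose first-order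 active set $\{j\in I(\bar x):\nabla h_j(\bar x)v=0\}$ equals $I_0(\bar x;u)$, the matrix of gradients of the functions in $\mathcal{A}_0(\bar x;u)$ has rank $\rho$ at $\gamma(t)$ for all sufficiently small $t>0$. (2) Parabolic arc-realizability: for every $w\in\mathcal{L}^2_S(\bar x;u)$ there exists a semialgebraic arc $\gamma:(0,\varepsilon)\to S$ with $\gamma(t)=\bar x+tu+\tfrac12t^2w+o(t^2)$ as $t\downarrow0$. *)

(* Defs.v *)
From HB Require Import structures.
From mathcomp Require Import all_boot all_order all_algebra.
From mathcomp Require Import all_classical all_reals all_analysis.
(* The notations of [mpoly] clash with those of [analysis]. *)
From mathcomp Require Import -(notations) mpoly.

Set Implicit Arguments.
Unset Strict Implicit.
Unset Printing Implicit Defensive.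

Import Order.TTheory GRing.Theory Num.Theory.
Import numFieldNormedType.Exports.

Local Open Scope classical_set_scope.
Local Open Scope ring_scope.

(* Points of R^n are column vectors and gradients are row vectors. The topology
   of 'cV[R]_n comes from the sup norm (written `|x|), which induces the same
   convergence, neighbourhoods, o and O as the Euclidean norm [enorm]. *)

Notation "{ 'mpoly' R [ n ] }" := (mpoly n R)
  (at level 0, R, n at level 2, format "{ 'mpoly'  R [ n ] }") : type_scope.

Definition enorm (R : realType) n (x : 'cV[R]_n) : R :=
  Num.sqrt (\sum_i x i 0 ^+ 2).

Definition peval (R : realType) n (p : {mpoly R[n]}) (x : 'cV[R]_n) : R :=
  meval (fun i => x i 0) p.

Definition grad (R : realType) n (p : {mpoly R[n]}) (x : 'cV[R]_n) : 'rV[R]_n :=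
  \row_i peval (mderiv i p) x.

Definition hess (R : realType) n (p : {mpoly R[n]}) (x : 'cV[R]_n) : 'M[R]_n :=
  \matrix_(i, j) peval (mderiv i (mderiv j p)) x.

Definition dgrad (R : realType) n (p : {mpoly R[n]}) (x v : 'cV[R]_n) : R :=
  (grad p x *m v) 0 0.

Definition qhess (R : realType) n (p : {mpoly R[n]}) (x u : 'cV[R]_n) : R :=
  (u^T *m hess p x *m u) 0 0.

Definition jacobian (R : realType) n k (p : 'I_k -> {mpoly R[n]})
  (x : 'cV[R]_n) : 'M[R]_(k, n) := \matrix_(i < k) grad (p i) x.

Definition basic_semialgebraic (R : realType) n (A : set 'cV[R]_n) : Prop :=
  exists eqs les lts : seq {mpoly R[n]},
    A = [set x | (forall p, p \in eqs -> peval p x = 0) /\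
                 (forall p, p \in les -> peval p x <= 0) /\
                 (forall p, p \in lts -> peval p x < 0)].

Definition semialgebraic (R : realType) n (A : set 'cV[R]_n) : Prop :=
  exists (k : nat) (B : 'I_k -> set 'cV[R]_n),
    (forall i, basic_semialgebraic (B i)) /\ A = \bigcup_i B i.

Definition locally_closed (T : topologicalType) (A : set T) : Prop :=
  exists O C : set T, open O /\ closed C /\ A = O `&` C.

Definition locally_described (R : realType) n r s (S : set 'cV[R]_n)
    (g : 'I_r -> {mpoly R[n]}) (h : 'I_s -> {mpoly R[n]}) (x : 'cV[R]_n) : Prop :=
  \forall y \near x,
    S y <-> (forall i, peval (g i) y = 0) /\ (forall j, peval (h j) y <= 0).

Definition tangent_cone (R : realType) n (S : set 'cV[R]_n) (x : 'cV[R]_n) :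
    set 'cV[R]_n :=
  [set u | exists (t : nat -> R) (v : nat -> 'cV[R]_n),
     (forall k, 0 < t k) /\ t @ \oo --> (0 : R) /\ v @ \oo --> u /\
     (forall k, S (x + t k *: v k))].

Definition critical (R : realType) n (f : {mpoly R[n]}) (S : set 'cV[R]_n)
    (x : 'cV[R]_n) : set 'cV[R]_n :=
  [set u | tangent_cone S x u /\ dgrad f x u = 0].

Definition active (R : realType) n s (h : 'I_s -> {mpoly R[n]})
    (x : 'cV[R]_n) : {set 'I_s} :=
  finset (fun j => peval (h j) x == 0).

Definition active0 (R : realType) n s (h : 'I_s -> {mpoly R[n]})
    (x u : 'cV[R]_n) : {set 'I_s} :=
  finset (fun j => (j \in active h x) && (dgrad (h j) x u == 0)).

Definition second_order_set (R : realType) n r s (g : 'I_r -> {mpoly R[n]})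
    (h : 'I_s -> {mpoly R[n]}) (x u : 'cV[R]_n) : set 'cV[R]_n :=
  [set w | (forall i, dgrad (g i) x w + qhess (g i) x u = 0) /\
           (forall j, j \in active0 h x u ->
              dgrad (h j) x w + qhess (h j) x u <= 0)].

(* An arc on (0, e) is a total function whose values outside (0, e) are
   irrelevant. *)
Definition feasible_arc (R : realType) n (S : set 'cV[R]_n) (e : R)
    (gam : R -> 'cV[R]_n) : Prop :=
  0 < e /\ {within `]0, e[, continuous gam} /\ (forall t : R, 0 < t < e -> S (gam t)).

Definition semialgebraic_arc (R : realType) n (S : set 'cV[R]_n) (e : R)
    (gam : R -> 'cV[R]_n) : Prop :=
  feasible_arc S e gam /\
  semialgebraic [set z : 'cV[R]_(1 + n) |
     exists2 t : R, 0 < t < e & z = col_mx t%:M (gam t)].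

Definition conic_nbhs (R : realType) n (u : 'cV[R]_n) (V : set 'cV[R]_n) : Prop :=
  nbhs u V /\ (forall (a : R) v, 0 < a -> V v -> V (a *: v)).

Definition active0_jacobian (R : realType) n r s (g : 'I_r -> {mpoly R[n]})
    (h : 'I_s -> {mpoly R[n]}) (x u y : 'cV[R]_n) :
    'M[R]_(r + #|active0 h x u|, n) :=
  col_mx (jacobian g y)
         (jacobian (fun k : 'I_#|active0 h x u| => h (enum_val k)) y).

Definition rank_stable (R : realType) n r s (S : set 'cV[R]_n)
    (g : 'I_r -> {mpoly R[n]}) (h : 'I_s -> {mpoly R[n]})
    (x u : 'cV[R]_n) : Prop :=
  exists (U V : set 'cV[R]_n) (rho : nat),
    nbhs x U /\ conic_nbhs u V /\
    forall (e : R) (gam : R -> 'cV[R]_n) (v : 'cV[R]_n),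
      feasible_arc S e gam ->
      V v ->
      (fun t : R => gam t - (x + t *: v)) =O_ ((0 : R)^'+) (fun t : R => t ^+ 2) ->
      (forall t : R, 0 < t < e -> U (gam t)) ->
      active0 h x v = active0 h x u ->
      \forall t \near (0 : R)^'+, \rank (active0_jacobian g h x u (gam t)) = rho.

Definition arc_realizable (R : realType) n r s (S : set 'cV[R]_n)
    (g : 'I_r -> {mpoly R[n]}) (h : 'I_s -> {mpoly R[n]})
    (x u : 'cV[R]_n) : Prop :=
  forall w, second_order_set g h x u w ->
  exists (e : R) (gam : R -> 'cV[R]_n),
    semialgebraic_arc S e gam /\
    (fun t : R => gam t - (x + t *: u + (t ^+ 2 / 2) *: w))
      =o_ ((0 : R)^'+) (fun t : R => t ^+ 2).

Definition parabolically_regular (R : realType) n r s (S : set 'cV[R]_n)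
    (g : 'I_r -> {mpoly R[n]}) (h : 'I_s -> {mpoly R[n]})
    (x u : 'cV[R]_n) : Prop :=
  rank_stable S g h x u /\ arc_realizable S g h x u.

Definition Qform (R : realType) n (f : {mpoly R[n]}) (x u w : 'cV[R]_n) : R :=
  dgrad f x w + qhess f x u.

Definition quadratic_growth (R : realType) n (f : {mpoly R[n]})
    (S : set 'cV[R]_n) (x : 'cV[R]_n) : Prop :=
  exists c e : R, 0 < c /\ 0 < e /\
    forall y, S y -> enorm (y - x) < e ->
      peval f x + c * enorm (y - x) ^+ 2 <= peval f y.

(* Main.v *)
Require Import Defs.
From HB Require Import structures.
From mathcomp Require Import all_boot all_order all_algebra.
From mathcomp Require Import all_classical all_reals all_analysis.
From mathcomp Require Import -(notations) mpoly.
From mathcomp Require Import ring lra.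

Set Implicit Arguments.
Unset Strict Implicit.
Unset Printing Implicit Defensive.

Import Order.TTheory GRing.Theory Num.Theory.
Import numFieldNormedType.Exports.

Local Open Scope classical_set_scope.
Local Open Scope ring_scope.

(** Suppose quadratic growth fails. Then there are points [y k] of [S] tending
    to [x] with [f (y k) < f x + r k * t k ^+ 2], where [t k] is the distance
    from [y k] to [x] and [r k] tends to 0. The unit vectors
    [v k = (y k - x) / t k] accumulate at a unit tangent vector [u], and
    [dgrad f x u <= 0], so that [u] is critical. The rescaled second-order
    deviations [w k = 2 (v k - u) / t k] need not be bounded, but [t k * w k]
    tends to 0; hence the second-order expansion of a polynomial [p] still reads
    [p (y k) = p x + t k * dgrad p x u
               + t k ^+ 2 / 2 * (dgrad p x (w k) + qhess p x u + o(1))].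
    Taking for [p] the equations, with both signs, the inequalities indexed by
    [active0 h x u], and [f] itself, whose derivatives along [u] all vanish,
    shows that [w k] solves up to o(1) the finite affine system
    [dgrad p x w + qhess p x u <= 0] (lemma [second_order_descent]).

    A finite system of affine inequalities that is solvable up to every positive
    error is solvable (lemma [affine_feasible_of_approx]); this is the
    closedness of polyhedral cones, and it replaces the compactness that the
    unbounded [w k] lack. An exact solution [w] lies in the second-order set of
    [u] and has [Qform f x u w <= 0], against the positive lower bound [eta].

    Limits are taken along an ultrafilter on [nat] finer than the filter of
    cofinite sets: every bounded sequence then converges, and no subsequence
    has to be extracted. *)

(** * Limits of vectors and the Euclidean norm *)

(** A cluster point of [f], which exists by compactness of [[a, b]], is a limit:
    the ultrafilter decides whether [f] is near that point, and the answer
    cannot be no. *)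
Lemma ultra_bounded_cvg (R : realType) (T : Type) (U : set_system T)
    (f : T -> R) (a b : R) : UltraFilter U ->
  (\forall k \near U, a <= f k <= b) -> exists l : R, f @ U --> l.
Proof.
move=> UU fab.
have [|l [_ cl]] := @segment_compact R a b (f @ U) _.
  by apply: filterS fab => k; rewrite /= in_itv.
exists l; apply/cvgrPdist_lt => e e0.
have [//|Ufar] := in_ultra_setVsetC [set k | `|l - f k| < e] UU.
have [] := cl (f @` [set k | ~ `|l - f k| < e]) [set y | `|l - y| < e].
- by apply: (@filterS _ U _ _ _ _ Ufar) => k fk; exists k.
- by apply/nbhs_ballP; exists e => //= y; rewrite -ball_normE.
- by move=> _ [[k far <-]].
Qed.

Lemma cvg_coord (R : realType) n (T : Type) (F : set_system T) {FF : Filter F}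
    (w : T -> 'cV[R]_n) (l : 'cV[R]_n) :
  (forall i, (fun k => w k i 0) @ F --> l i 0) -> w @ F --> l.
Proof.
move=> wl A [P Pl PA].
have : \forall k \near F, forall i, P i 0 (w k i 0).
  by apply: filter_forall => i; apply: wl; apply: Pl.
by apply: filterS => k Pk; apply: PA => i j; rewrite (ord1 j); apply: Pk.
Qed.

Lemma coord_cvg (R : realType) n (T : Type) (F : set_system T) {FF : Filter F}
    (w : T -> 'cV[R]_n) (l : 'cV[R]_n) i :
  w @ F --> l -> (fun k => w k i 0) @ F --> l i 0.
Proof.
move=> wl.
exact: (cvg_comp w (fun M : 'cV[R]_n => M i 0) wl (@coord_continuous R n 1 i 0 l)).
Qed.

Lemma cvg_mulmx_row (R : realType) n (T : Type) (F : set_system T) {FF : Filter F}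
    (a : 'rV[R]_n) (w : T -> 'cV[R]_n) (l : 'cV[R]_n) :
  w @ F --> l -> (fun k => (a *m w k) 0 0) @ F --> (a *m l) 0 0.
Proof.
move=> wl; under eq_fun do rewrite mxE; rewrite mxE.
apply: (@cvg_big R 'I_n +%R 0 xpredT); first exact: add_continuous.
by move=> i _; apply: cvgMr; apply: coord_cvg.
Qed.

Arguments cvg_mulmx_row {R n T F FF} a [w l].

Lemma enorm_ge0 (R : realType) n (x : 'cV[R]_n) : 0 <= enorm x.
Proof. exact: sqrtr_ge0. Qed.

Lemma sqr_enorm (R : realType) n (x : 'cV[R]_n) :
  enorm x ^+ 2 = (x^T *m x) 0 0.
Proof.
rewrite sqr_sqrtr; last by apply: sumr_ge0 => i _; exact: sqr_ge0.
by rewrite mxE; apply: eq_bigr => i _; rewrite mxE expr2.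
Qed.

Lemma enormZ (R : realType) n (a : R) (x : 'cV[R]_n) :
  enorm (a *: x) = `|a| * enorm x.
Proof.
rewrite /enorm -sqrtr_sqr -sqrtrM ?sqr_ge0//; congr Num.sqrt.
by rewrite mulr_sumr; apply: eq_bigr => i _; rewrite mxE exprMn.
Qed.

Lemma ler_coord_enorm (R : realType) n (x : 'cV[R]_n) i : `|x i 0| <= enorm x.
Proof.
rewrite -sqrtr_sqr ler_sqrt; last by apply: sumr_ge0 => j _; exact: sqr_ge0.
by rewrite (bigD1 i)//= lerDl; apply: sumr_ge0 => j _; exact: sqr_ge0.
Qed.

Lemma enorm_eq0 (R : realType) n (x : 'cV[R]_n) : enorm x = 0 -> x = 0.
Proof.
move=> x0; apply/matrixP => i j; rewrite (ord1 j) mxE.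
by apply/eqP; rewrite -normr_le0 -x0 ler_coord_enorm.
Qed.

Lemma sqr_enormB (R : realType) n (x y : 'cV[R]_n) :
  enorm (x - y) ^+ 2 = enorm x ^+ 2 - 2 * (y^T *m x) 0 0 + enorm y ^+ 2.
Proof.
have dT : (x - y)^T = x^T - y^T by exact: linearB.
rewrite !sqr_enorm dT mulmxBl !mulmxBr.
have -> : x^T *m y = (y^T *m x)^T by rewrite trmx_mul trmxK.
rewrite !mxE; ring.
Qed.

Lemma cvg_enorm2 (R : realType) n (T : Type) (F : set_system T) {FF : Filter F}
    (w : T -> 'cV[R]_n) (l : 'cV[R]_n) :
  w @ F --> l -> (fun k => enorm (w k) ^+ 2) @ F --> enorm l ^+ 2.
Proof.
move=> wl; under eq_fun do rewrite sqr_enorm mxE; rewrite sqr_enorm mxE.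
apply: (@cvg_big R 'I_n +%R 0 xpredT); first exact: add_continuous.
by move=> i _; rewrite mxE; under eq_fun do rewrite mxE; apply: cvgM; apply: coord_cvg.
Qed.

Lemma ultra_enorm_cvg (R : realType) n (T : Type) (U : set_system T)
    (w : T -> 'cV[R]_n) (M : R) : UltraFilter U ->
  (\forall k \near U, enorm (w k) <= M) -> exists l : 'cV[R]_n, w @ U --> l.
Proof.
move=> UU wM.
have /choice[l wl] i : exists l : R, (fun k => w k i 0) @ U --> l.
  apply: (@ultra_bounded_cvg _ _ _ _ (- M) M) => //; apply: filterS wM => k wkM.
  by rewrite -ler_norml (le_trans (ler_coord_enorm _ _)).
by exists (\col_i l i); apply: cvg_coord => i; rewrite mxE.
Qed.

Lemma ultra_unit_cvg (R : realType) n (T : Type) (U : set_system T)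
    (w : T -> 'cV[R]_n) : UltraFilter U ->
  (\forall k \near U, enorm (w k) = 1) ->
  exists2 l : 'cV[R]_n, w @ U --> l & enorm l = 1.
Proof.
move=> UU w1; have [|l wl] := @ultra_enorm_cvg _ _ _ _ w 1 UU.
  by apply: filterS w1 => k ->.
exists l => //; apply: (@pexpIrn _ 2); rewrite ?nnegrE ?enorm_ge0//.
rewrite expr1n; apply/eqP; rewrite eq_le; apply/andP; split.
  by apply: cvgr_to_le (cvg_enorm2 wl) _; apply: filterS w1 => k ->; rewrite expr1n.
by apply: cvgr_to_ge (cvg_enorm2 wl) _; apply: filterS w1 => k ->; rewrite expr1n.
Qed.

(** * Approximate solvability of affine systems *)

(** Take solutions [w k] up to error [1 / (k + 1)] whose squared norm is minimal
    up to 1. If they stay bounded, their limit is an exact solution. Otherwise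
    the directions of the [w k] converge to a unit vector [u] of the recession
    cone ([a i *m u <= 0] for all [i]). Subtracting [u] from [w k] keeps it
    feasible for large [k]: a constraint with [a i *m u = 0] does not see the
    change, and one with [a i *m u < 0] has unbounded slack. This
    lowers the squared norm by about [2 * enorm (w k)], which contradicts the
    minimality. *)
Lemma affine_feasible_of_approx (R : realType) n (I : finType)
    (a : I -> 'rV[R]_n) (b : I -> R) :
  (forall e : R, 0 < e -> exists w : 'cV[R]_n, forall i, (a i *m w) 0 0 <= b i + e) ->
  exists w : 'cV[R]_n, forall i, (a i *m w) 0 0 <= b i.
Proof.
move=> approx.
pose feas (e : R) (w : 'cV[R]_n) := forall i, (a i *m w) 0 0 <= b i + e.
have /choice[w wP] (k : nat) : exists w, feas k.+1%:R^-1 w /\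
    forall w', feas k.+1%:R^-1 w' -> enorm w ^+ 2 <= enorm w' ^+ 2 + 1.
  set e : R := k.+1%:R^-1; pose E := [set enorm w ^+ 2 | w in feas e].
  have lbE : has_lbound E by exists 0 => _ [w' _ <-]; exact: sqr_ge0.
  have infE : has_inf E.
    split=> //; have [|w0 w0P] := approx e; first by rewrite invr_gt0.
    by exists (enorm w0 ^+ 2), w0.
  have [_ [w0 w0P <-] w0inf] := inf_adherent (@ltr01 R) infE.
  exists w0; split=> // w' w'P; rewrite (le_trans (ltW w0inf))// lerD2r.
  by apply: ge_inf => //; exists w'.
have [U [UU ooU]] := ultraFilterLemma (@eventually_filter : ProperFilter \oo).
have PU : ProperFilter U by exact: ultra_proper.
have [[M wM]|unbounded] := pselect (exists M, \forall k \near U, enorm (w k) <= M).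
  have [l wl] := ultra_enorm_cvg UU wM; exists l => i.
  have U0 : (fun k => k.+1%:R^-1) @ U --> (0 : R).
    by move=> A /cvg_harmonic; exact: ooU.
  have wil : (fun k => (a i *m w k) 0 0 - k.+1%:R^-1) @ U --> (a i *m l) 0 0 - 0.
    exact: cvgB (cvg_mulmx_row (a i) wl) U0.
  rewrite -[X in X <= _]subr0; apply: cvgr_to_le wil _.
  by apply: nearW => k; rewrite /= lerBlDr; exact: (wP k).1.
have large M : \forall k \near U, M < enorm (w k).
  have [UM|] := in_ultra_setVsetC [set k | enorm (w k) <= M] UU.
    by case: unbounded; exists M.
  by apply: filterS => k /= /negP; rewrite -ltNge.
pose v k := (enorm (w k))^-1 *: w k.
have [|u vu u1] := @ultra_unit_cvg _ _ _ _ v UU.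
  apply: filterS (large 0) => k wk0.
  by rewrite enormZ ger0_norm ?invr_ge0 ?enorm_ge0// mulVf// gt_eqF.
have wE k : 0 < enorm (w k) -> w k = enorm (w k) *: v k.
  by move=> wk0; rewrite scalerA mulfV ?scale1r// gt_eqF.
have au i : (a i *m u) 0 0 <= 0.
  apply/ler_addgt0Pr => e e0; rewrite add0r.
  apply: cvgr_to_le (cvg_mulmx_row (a i) vu) _.
  apply: filterS2 (large 0) (large ((b i + 1) / e)) => k wk0.
  rewrite ltr_pdivrMr// => wke; rewrite -scalemxAr mxE mulrC ler_pdivrMr//.
  rewrite mulrC (le_trans _ (ltW wke))// (le_trans ((wP k).1 i))// lerD2l.
  by rewrite invf_le1// ler1n.
have rowB i k : (a i *m (w k - u)) 0 0 = (a i *m w k) 0 0 - (a i *m u) 0 0.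
  by rewrite mulmxBr !mxE.
have shift : \forall k \near U, feas k.+1%:R^-1 (w k - u).
  apply: filter_forall => i; have := au i; rewrite le_eqVlt => /predU1P[au0|].
    apply: nearW => k; rewrite rowB au0 subr0.
    exact: (wP k).1.
  set c : R := (a i *m u) 0 0 => c0.
  have vc : \forall k \near U, (a i *m v k) 0 0 < c / 2.
    by apply: (cvgr_lt c (cvg_mulmx_row (a i) vu)); lra.
  (* The threshold makes [N * (c / 2) < b i + c], where [N = enorm (w k)]. *)
  apply: filterS3 vc (large 0) (large (2 * b i / c + 2)) => k vkc wk0 wkM.
  rewrite rowB -/c {1}wE// -scalemxAr mxE.
  set N := enorm (w k) in wk0 wkM *.
  have : N * c < (2 * b i / c + 2) * c by rewrite ltr_nM2r.
  rewrite mulrDl mulfVK ?lt_eqF// => Nc.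
  have : N * (a i *m v k) 0 0 < N * (c / 2) by rewrite ltr_pM2l.
  have : 0 <= k.+1%:R^-1 :> R by rewrite invr_ge0.
  by move: k.+1%:R^-1 => e e0 Ny; lra.
have inner : \forall k \near U, 1 / 2 < (u^T *m v k) 0 0.
  apply: (cvgr_gt _ (cvg_mulmx_row u^T vu)).
  by rewrite -sqr_enorm u1; lra.
have [k [[uvk Nk] Fk]] := filter_ex (filterI (filterI inner (large 4)) shift).
have := (wP k).2 _ Fk; rewrite sqr_enormB u1 {3}wE; last by lra.
rewrite -scalemxAr mxE; set N := enorm (w k) in Nk *.
have : 4 * (1 / 2) < N * (u^T *m v k) 0 0 by apply: ltr_pM; lra.
by lra.
Qed.

(** * Second-order expansion of polynomials *)

Section SecondOrderExpansion.
Variables (R : realType) (n : nat).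
Implicit Types (p q : {mpoly R[n]}) (x u : 'cV[R]_n).

Lemma mpoly_ring_ind (P : {mpoly R[n]} -> Prop) :
  (forall c, P (mpolyC n c)) -> (forall i, P (mpolyX R (mnm1 i))) ->
  (forall p q, P p -> P q -> P (p + q)) ->
  (forall p q, P p -> P q -> P (p * q)) -> forall p, P p.
Proof.
move=> PC PX PD PM; elim/mpolyind => [|c m p _ _ Pp]; first by rewrite -mpolyC0.
apply: PD => //; rewrite -mul_mpolyC; apply: (PM) => //; rewrite mpolyXE_id.
apply: big_ind => [||i _]; [by rewrite -mpolyC1|exact: PM|].
by elim: (m i) => [|k IH]; rewrite ?expr0 -?mpolyC1// exprS; apply: PM.
Qed.

Lemma pevalD p q x : peval (p + q) x = peval p x + peval q x.
Proof. exact: mevalD. Qed.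
Lemma pevalM p q x : peval (p * q) x = peval p x * peval q x.
Proof. exact: mevalM. Qed.
Lemma pevalN p x : peval (- p) x = - peval p x.
Proof. exact: mevalN. Qed.

Lemma dgradE p x u : dgrad p x u = \sum_i peval (mderiv i p) x * u i 0.
Proof. by rewrite /dgrad mxE; apply: eq_bigr => i _; rewrite mxE. Qed.

Lemma qhessE p x u :
  qhess p x u = \sum_i \sum_j peval (mderiv j (mderiv i p)) x * (u i 0 * u j 0).
Proof.
rewrite /qhess mxE; apply: eq_bigr => i _; rewrite mxE mulr_suml.
by apply: eq_bigr => j _; rewrite !mxE; ring.
Qed.

Lemma dgradD p q x u : dgrad (p + q) x u = dgrad p x u + dgrad q x u.
Proof.
by rewrite !dgradE -big_split; apply: eq_bigr => i _; rewrite mderivD pevalD mulrDl.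
Qed.

Lemma qhessD p q x u : qhess (p + q) x u = qhess p x u + qhess q x u.
Proof.
rewrite !qhessE -big_split; apply: eq_bigr => i _; rewrite -big_split.
by apply: eq_bigr => j _; rewrite !mderivD pevalD mulrDl.
Qed.

Lemma dgradN p x u : dgrad (- p) x u = - dgrad p x u.
Proof.
by rewrite !dgradE -sumrN; apply: eq_bigr => i _; rewrite mderivN pevalN mulNr.
Qed.

Lemma qhessN p x u : qhess (- p) x u = - qhess p x u.
Proof.
rewrite !qhessE -sumrN; apply: eq_bigr => i _; rewrite -sumrN.
by apply: eq_bigr => j _; rewrite !mderivN pevalN mulNr.
Qed.

Lemma dgradM p q x u :
  dgrad (p * q) x u = dgrad p x u * peval q x + peval p x * dgrad q x u.
Proof.
rewrite !dgradE mulr_suml mulr_sumr -big_split; apply: eq_bigr => i _ /=.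
by rewrite mderivM pevalD !pevalM; ring.
Qed.

Lemma qhessM p q x u : qhess (p * q) x u =
  qhess p x u * peval q x + peval p x * qhess q x u
  + 2 * (dgrad p x u * dgrad q x u).
Proof.
have -> : 2 * (dgrad p x u * dgrad q x u) =
    \sum_i \sum_j (peval (mderiv i p) x * peval (mderiv j q) x
      + peval (mderiv j p) x * peval (mderiv i q) x) * (u i 0 * u j 0).
  rewrite mulr2n mulrDl mul1r {1}[dgrad p x u * _]mulrC !dgradE.
  rewrite !big_distrlr -big_split; apply: eq_bigr => i _ /=.
  by rewrite -big_split; apply: eq_bigr => j _ /=; ring.
rewrite !qhessE mulr_suml mulr_sumr -!big_split; apply: eq_bigr => i _ /=.
rewrite mulr_suml mulr_sumr -!big_split; apply: eq_bigr => j _ /=.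
by rewrite mderivM mderivD !mderivM !pevalD !pevalM; ring.
Qed.

Lemma dgradDr p x u v : dgrad p x (u + v) = dgrad p x u + dgrad p x v.
Proof. by rewrite /dgrad mulmxDr mxE. Qed.

Lemma dgradZr p x a u : dgrad p x (a *: u) = a * dgrad p x u.
Proof. by rewrite /dgrad -scalemxAr mxE. Qed.

(** The first-order term is taken along the moving direction [v k] and the
    second-order one along its limit [u]. No rate is imposed on the convergence
    of [v] to [u], which is what allows unbounded second-order deviations.
    Stated as a limit, the expansion passes to sums and products, so that
    constants and variables are the only cases to compute. *)
Lemma cvg_peval_taylor2 (T : Type) (F : set_system T) (t : T -> R)
    (v : T -> 'cV[R]_n) p x u : Filter F -> (forall k, t k != 0) ->
  t @ F --> (0 : R) -> v @ F --> u ->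
  (fun k => (peval p (x + t k *: v k) - peval p x - t k * dgrad p x (v k))
            / t k ^+ 2) @ F --> qhess p x u / 2.
Proof.
move=> FF t_neq0 t0 vu; elim/mpoly_ring_ind: p => [c|i|p q Ep Eq|p q Ep Eq].
- rewrite qhessE big1 ?mul0r; last first.
    by move=> i _; apply: big1 => j _; rewrite !mderivC /peval meval0 mul0r.
  apply: cvg_near_cst; apply: nearW => k; rewrite dgradE big1; last first.
    by move=> i _; rewrite mderivC /peval meval0 mul0r.
  by rewrite /peval !mevalC subrr mulr0 subr0 mul0r.
- have dX j : mderiv j (mpolyX R (mnm1 i)) = mpolyC n (i == j)%:R.
    rewrite mderivX mnm1E; case: eqP => [->|_]; last by rewrite scale0r mpolyC0.
    rewrite scale1r (_ : mnm_sub _ _ = mnm0) ?mpolyX0 ?mpolyC1//.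
    by apply/mnmP => l; rewrite mnmBE subnn mnm0E.
  rewrite qhessE big1 ?mul0r; last first.
    by move=> j _; apply: big1 => l _; rewrite dX mderivC /peval meval0 mul0r.
  apply: cvg_near_cst; apply: nearW => k.
  rewrite dgradE (bigD1 i)//= big1; last first.
    by move=> j ij; rewrite dX eq_sym (negPf ij) /peval mevalC mul0r.
  rewrite dX eqxx /peval mevalC !mevalXU !mxE mul1r addr0.
  rewrite [X in X / _](_ : _ = 0) ?mul0r//.
  by rewrite [X in X - _]addrAC subrr add0r subrr.
- rewrite qhessD mulrDl; apply: cvg_trans (cvgD Ep Eq); apply: near_eq_cvg.
  by apply: nearW => k; rewrite addrfctE /= !pevalD dgradD; ring.
pose E p' k := (peval p' (x + t k *: v k) - peval p' x - t k * dgrad p' x (v k))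
  / t k ^+ 2.
have dp : (fun k => dgrad p x (v k)) @ F --> dgrad p x u by exact: cvg_mulmx_row.
have dq : (fun k => dgrad q x (v k)) @ F --> dgrad q x u by exact: cvg_mulmx_row.
have EM k : (peval (p * q) (x + t k *: v k) - peval (p * q) x
      - t k * dgrad (p * q) x (v k)) / t k ^+ 2
    = E p k * peval q x + peval p x * E q k + dgrad p x (v k) * dgrad q x (v k)
      + t k * (dgrad p x (v k) * E q k + E p k * dgrad q x (v k))
      + t k * t k * (E p k * E q k).
  by rewrite /E !pevalM dgradM; field; apply: t_neq0.
under eq_fun do rewrite EM.
have -> : qhess (p * q) x u / 2 =
    qhess p x u / 2 * peval q x + peval p x * (qhess q x u / 2)
      + dgrad p x u * dgrad q x u
      + 0 * (dgrad p x u * (qhess q x u / 2) + qhess p x u / 2 * dgrad q x u)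
      + 0 * 0 * (qhess p x u / 2 * (qhess q x u / 2)).
  by rewrite qhessM; field.
by do !(exact: Ep || exact: Eq || exact: dp || exact: dq || exact: t0
  || exact: cvg_cst || apply: cvgD || apply: cvgM).
Qed.

End SecondOrderExpansion.

(** * Consequences of descent along a tangential sequence *)

(** The tangent cone asks for a sequence indexed by [nat] along [\oo]; it is
    picked diagonally, one element of the filter base at a time. *)
Lemma tangent_cone_of_filter (R : realType) n (S : set 'cV[R]_n) (x u : 'cV[R]_n)
    (T : Type) (F : set_system T) {PF : ProperFilter F}
    (t : T -> R) (v : T -> 'cV[R]_n) :
  (forall k, 0 < t k) -> t @ F --> (0 : R) -> v @ F --> u ->
  (forall k, S (x + t k *: v k)) -> tangent_cone S x u.
Proof.
move=> t_gt0 t0 vu Sv.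
have /choice[m mP] (k : nat) :
    exists m, t m < k.+1%:R^-1 /\ `|u - v m| < k.+1%:R^-1.
  have k0 : (0 : R) < k.+1%:R^-1 by rewrite invr_gt0.
  have tk : \forall m \near F, t m < k.+1%:R^-1 by exact: cvgr_lt t0 _ k0.
  have vk : \forall m \near F, `|u - v m| < k.+1%:R^-1 by exact: cvgr_dist_lt vu _ k0.
  exact: filter_ex (filterI tk vk).
exists (t \o m), (v \o m); split; first by move=> k; exact: t_gt0.
split.
  apply: (@squeeze_cvgr _ _ _ _ (cst 0) (@harmonic R)); last exact: cvg_harmonic.
    by apply: nearW => k /=; rewrite (ltW (t_gt0 _)) (ltW (mP k).1).
  exact: cvg_cst.
split; last by move=> k; exact: Sv.
apply/cvgrPdist_lt => e e0.
have small : \forall k \near \oo, @harmonic R k < e by exact: cvgr_lt cvg_harmonic _ e0.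
by apply: filterS small => k; apply: lt_trans (mP k).2.
Qed.

Section Descent.
Variables (R : realType) (n : nat) (T : Type) (F : set_system T).
Context {PF : ProperFilter F}.
Variables (t r : T -> R) (v : T -> 'cV[R]_n) (x u : 'cV[R]_n).
Hypotheses (t_gt0 : forall k, 0 < t k) (t0 : t @ F --> (0 : R)).
Hypotheses (r0 : r @ F --> (0 : R)) (vu : v @ F --> u).
Variable p : {mpoly R[n]}.
Hypothesis descent : \forall k \near F,
  peval p (x + t k *: v k) <= peval p x + r k * t k ^+ 2.

Let E k := (peval p (x + t k *: v k) - peval p x - t k * dgrad p x (v k))
           / t k ^+ 2.

Let E_lim : E @ F --> qhess p x u / 2.
Proof. by apply: cvg_peval_taylor2 => // k; rewrite gt_eqF. Qed.

(* The descent condition, solved for the first-order term. *)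
Let descentE : \forall k \near F, dgrad p x (v k) <= t k * (r k - E k).
Proof.
apply: filterS descent => k; rewrite -lerBlDl => le_r.
have tk0 := t_gt0 k; have tk_neq0 : t k != 0 by rewrite gt_eqF.
have -> : t k * (r k - E k) = (r k * t k ^+ 2
    - (peval p (x + t k *: v k) - peval p x)) / t k + dgrad p x (v k).
  by rewrite /E; field.
by rewrite lerDr divr_ge0 ?(ltW tk0)// subr_ge0.
Qed.

(** The right-hand side of [descentE] tends to 0. *)
Lemma dgrad_le0_of_descent : dgrad p x u <= 0.
Proof.
have lim : (fun k => t k * (r k - E k)) @ F --> 0 * (0 - qhess p x u / 2).
  by apply: cvgM => //; apply: cvgB.
have dlim : (fun k => dgrad p x (v k)) @ F --> dgrad p x u by exact: cvg_mulmx_row.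
rewrite leNgt; apply/negP => d_gt0.
have small : \forall k \near F, t k * (r k - E k) < dgrad p x u / 2.
  by apply: cvgr_lt lim _ _; lra.
have large : \forall k \near F, dgrad p x u / 2 < dgrad p x (v k).
  by apply: cvgr_gt dlim _ _; lra.
have [k [[small_k large_k] le_k]] := filter_ex (filterI (filterI small large) descentE).
by move: small_k large_k le_k => /=; lra.
Qed.

(** When [dgrad p x u] vanishes, dividing [descentE] by [t k / 2] is meaningful:
    the left-hand side becomes the derivative along the second-order deviation
    and the right-hand side tends to [- qhess p x u]. *)
Lemma second_order_descent (e : R) : dgrad p x u = 0 -> 0 < e ->
  \forall k \near F, dgrad p x ((2 / t k) *: (v k - u)) <= - qhess p x u + e.
Proof.
move=> du0 e0.
have lim : (fun k => 2 * (r k - E k)) @ F --> 2 * (0 - qhess p x u / 2).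
  by apply: cvgM; [exact: cvg_cst|exact: cvgB].
have small : \forall k \near F, 2 * (r k - E k) < - qhess p x u + e.
  by apply: cvgr_lt lim _ _; lra.
apply: filterS2 small descentE => k small_k le_k.
apply: le_trans (ltW small_k).
rewrite dgradZr dgradDr -[- u]scaleN1r dgradZr du0 mulr0 addr0.
by rewrite mulrAC ler_pdivrMr// -mulrA ler_pM2l// [leRHS]mulrC.
Qed.

End Descent.

(** * Quadratic growth *)

Theorem theorem6p2 (R : realType) (n r s : nat) (f : {mpoly R[n]})
    (S : set 'cV[R]_n) (g : 'I_r -> {mpoly R[n]}) (h : 'I_s -> {mpoly R[n]})
    (x : 'cV[R]_n)
    (Slc : locally_closed S) (Ssa : basic_semialgebraic S) (Sx : S x)
    (Sgh : locally_described S g h x)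
    (first_order : forall v, tangent_cone S x v -> 0 <= dgrad f x v)
    (regular : forall u, critical f S x u -> u != 0 ->
       parabolically_regular S g h x u)
    (second_order : exists eta : R, 0 < eta /\
       forall u w, critical f S x u -> enorm u = 1 ->
         second_order_set g h x u w -> eta <= Qform f x u w) :
  quadratic_growth f S x.
Proof.
have [eta [eta0 Qge]] := second_order.
apply: contrapT => no_growth.
have /choice[y yP] (k : nat) : exists y, [/\ S y, enorm (y - x) < k.+1%:R^-1
    & peval f y < peval f x + k.+1%:R^-1 * enorm (y - x) ^+ 2].
  apply: contrapT => none; apply: no_growth.
  exists k.+1%:R^-1, k.+1%:R^-1; rewrite !invr_gt0 !ltr0n; split=> //; split=> //.
  move=> y Sy yx; rewrite leNgt; apply/negP => fy; apply: none.
  by exists y.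
pose t k := enorm (y k - x); pose v k := (t k)^-1 *: (y k - x).
have t_gt0 k : 0 < t k.
  rewrite lt_def enorm_ge0 andbT; apply/eqP => tk0.
  have [_ _] := yP k; rewrite -/(t k) tk0 expr0n mulr0 addr0.
  by rewrite -[y k](subrK x) (enorm_eq0 tk0) add0r ltxx.
have yE k : x + t k *: v k = y k.
  by rewrite scalerA mulfV ?gt_eqF// scale1r addrC subrK.
have [U [UU ooU]] := ultraFilterLemma (@eventually_filter : ProperFilter \oo).
have PU : ProperFilter U by exact: ultra_proper.
have r0 : (fun k => k.+1%:R^-1) @ U --> (0 : R).
  by move=> A /cvg_harmonic; exact: ooU.
have t0 : t @ U --> (0 : R).
  apply: (squeeze_cvgr _ (cvg_cst 0) r0); apply: nearW => k /=.
  by rewrite (ltW (t_gt0 k)); have [_ /ltW] := yP k.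
have [|u vu u1] := @ultra_unit_cvg _ _ _ _ v UU.
  apply: nearW => k; rewrite enormZ ger0_norm ?invr_ge0 ?(ltW (t_gt0 k))//.
  by rewrite mulVf// gt_eqF.
have yx : y @ U --> x.
  rewrite -(funext yE) -[X in _ --> X]addr0 -(scale0r u).
  by apply: cvgD; [exact: cvg_cst|exact: cvgZ].
have Su : tangent_cone S x u.
  by apply: (tangent_cone_of_filter t_gt0 t0 vu) => k; rewrite yE; have [] := yP k.
(* The two signs of [g i] turn the equations of the second-order set into
   inequalities; [f] completes the system so that a solution violates the
   lower bound on [Qform]. *)
pose p (i : option ('I_r + 'I_r + {j | j \in active0 h x u})) :=
  match i with
  | None => f
  | Some (inl (inl i)) => g i
  | Some (inl (inr i)) => - g i
  | Some (inr j) => h (val j)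
  end.
have [gx _] : (forall i, peval (g i) x = 0) /\ (forall j, peval (h j) x <= 0).
  by have /nbhs_singleton[+ _] := Sgh; apply.
have Sy : \forall k \near U,
    (forall i, peval (g i) (y k) = 0) /\ (forall j, peval (h j) (y k) <= 0).
  apply: (@filterS _ U _ _ _ _ (yx _ Sgh)) => k [gh _].
  by apply: gh; have [] := yP k.
have descent i : \forall k \near U,
    peval (p i) (x + t k *: v k) <= peval (p i) x + k.+1%:R^-1 * t k ^+ 2.
  apply: filterS Sy => k [gy hy]; rewrite yE.
  have slack : 0 <= k.+1%:R^-1 * t k ^+ 2 by rewrite mulr_ge0 ?invr_ge0 ?sqr_ge0.
  case: i => [[[i|i]|[j jP]]|] /=; rewrite ?pevalN ?gy ?gx ?oppr0 ?add0r//.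
    move: jP; rewrite inE => /andP[]; rewrite inE => /eqP-> _.
    by rewrite add0r (le_trans (hy j)).
  by have [_ _ /ltW] := yP k.
have dp_le0 i : dgrad (p i) x u <= 0.
  exact: dgrad_le0_of_descent t_gt0 t0 r0 vu _ (descent i).
have dp0 i : dgrad (p i) x u = 0.
  apply/eqP; rewrite eq_le dp_le0 /=.
  case: i => [[[i|i]|[j jP]]|] /=.
  - by have := dp_le0 (Some (inl (inr i))); rewrite /= dgradN oppr_le0.
  - by rewrite dgradN oppr_ge0; exact: dp_le0 (Some (inl (inl i))).
  - by move: jP; rewrite inE => /andP[_ /eqP->].
  - exact: first_order.
have [e e0|w wP] := @affine_feasible_of_approx R n _ (fun i => grad (p i) x)
    (fun i => - qhess (p i) x u).
  have [k kP] := filter_ex (filter_forall _ (fun i =>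
    second_order_descent t_gt0 t0 r0 vu (descent i) (dp0 i) e0)).
  by exists ((2 / t k) *: (v k - u)).
have dw i : dgrad (p i) x w + qhess (p i) x u <= 0 by rewrite -lerBrDr sub0r; exact: wP.
have Lw : second_order_set g h x u w.
  split=> [i|j jP]; last exact: dw (Some (inr (exist _ j jP))).
  apply/eqP; rewrite eq_le (dw (Some (inl (inl i)))) /=.
  by have := dw (Some (inl (inr i))); rewrite /= dgradN qhessN -opprD oppr_le0.
by have := Qge u w (conj Su (dp0 None)) u1 Lw; have := dw None; rewrite /= /Qform; lra.
Qed.
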